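(* For every $\epsilon>0$ and every positive integer $L$ there is a positive integer $M$ such that, for all integers $m,n\ge M$, every real $m\times n$ matrix $A$ has an $(\epsilon)$-regular block partition $(\mathcal P,\mathcal Q)$ with $|\mathcal P|,|\mathcal Q|\in[L,M]$.
   Context: Let $A=(a_{xy})$ be a real matrix with rows indexed by a finite set $V$ and columns indexed by a finite set $W$. Write $\|A\|=\sum_{x\in V,y\in W}|a_{xy}|$. For $X\subset V$, $Y\subset W$ nonempty, $w_A(X,Y)=\sum_{x\in X,y\in Y}a_{xy}$ and the density is $d_A(X,Y)=w_A(X,Y)/(|X||Y|)$. The submatrix $A_{X,Y}$ (or the block $(X,Y)$) is $\epsilon$-regular if for all $X'\subset X$, $Y'\subset Y$ with $|X'|\ge\epsilon|X|$ and $|Y'|\ge\epsilon|Y|$ we have $|d_A(X',Y')-d_A(X,Y)|\le\epsilon$. A block partition $(\mathcal P,\mathcal Q)$ of $A$ consists of a partition $\mathcal P$ of $V$ and a partition $\mathcal Q$ of $W$, together with designated (possibly empty) exceptional classes $V_0\in\mathcal P$ and $W_0\in\mathcal Q$; its blocks are the submatrices $A_{X,Y}$, $X\in\mathcal P$, $Y\in\mathcal Q$, and the nonexceptional blocks are those with $X\ne V_0$, $Y\ne W_0$. $|\mathcal P|$ denotes the number of nonexceptional classes of $\mathcal P$ (similarly $|\mathcal Q|$). A partition with exceptional set is balanced if all its nonexceptional classes have the same size. The block partition is $\epsilon$-regular if $\mathcal P$ and $\mathcal Q$ are balanced, $|V_0|<\epsilon|V|$, $|W_0|<\epsilon|W|$,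 and all but at most $\epsilon|\mathcal P||\mathcal Q|$ of the nonexceptional blocks are $\epsilon$-regular. The block partition is $(\epsilon)$-regular if it is an $\epsilon$-regular block partition of the normalized matrix $A^*=\frac{|V||W|}{\|A\|}A$. *)

(* Defs.v *)
From mathcomp Require Import all_boot all_order all_algebra.
From mathcomp Require Import reals.

Set Implicit Arguments.
Unset Strict Implicit.
Unset Printing Implicit Defensive.

Import Order.TTheory GRing.Theory Num.Theory.
Local Open Scope ring_scope.

(* The exceptional class is a member of [classes] and is the only class that
   is allowed to be empty. *)
Record expartition (T : finType) := ExPartition {
  classes : {set {set T}};
  exceptional : {set T};
  expartitionP : [&& exceptional \in classes, trivIset classes,
                     cover classes == [set: T]
                   & set0 \notin classes :\ exceptional] }.

Definition nonexceptional (T : finType) (P : expartition T) : {set {set T}} :=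
  classes P :\ exceptional P.

(* This is $|\mathcal P|$: the exceptional class is not counted. *)
Definition nclasses (T : finType) (P : expartition T) : nat :=
  #|nonexceptional P|.

Definition balanced (T : finType) (P : expartition T) : Prop :=
  {in nonexceptional P &, forall X Y : {set T}, #|X| = #|Y|}.

Definition mx_l1norm (R : realType) (m n : nat) (A : 'M[R]_(m, n)) : R :=
  \sum_(x < m) \sum_(y < n) `|A x y|.

Definition weight (R : realType) (m n : nat) (A : 'M[R]_(m, n))
    (X : {set 'I_m}) (Y : {set 'I_n}) : R :=
  \sum_(x in X) \sum_(y in Y) A x y.

Definition density (R : realType) (m n : nat) (A : 'M[R]_(m, n))
    (X : {set 'I_m}) (Y : {set 'I_n}) : R :=
  weight A X Y / (#|X|%:R * #|Y|%:R).

(* For [0 < eps] and nonempty [X], [Y] the size conditions force [X'] and [Y']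
   to be nonempty, so no density with zero denominator occurs. *)
Definition regular_block (R : realType) (eps : R) (m n : nat)
    (A : 'M[R]_(m, n)) (X : {set 'I_m}) (Y : {set 'I_n}) : bool :=
  [forall X' : {set 'I_m}, forall Y' : {set 'I_n},
    [&& X' \subset X, Y' \subset Y,
        eps * #|X|%:R <= #|X'|%:R & eps * #|Y|%:R <= #|Y'|%:R]
    ==> (`|density A X' Y' - density A X Y| <= eps)].

Definition irregular_blocks (R : realType) (eps : R) (m n : nat)
    (A : 'M[R]_(m, n)) (P : expartition 'I_m) (Q : expartition 'I_n) :
    {set {set 'I_m} * {set 'I_n}} :=
  [set B in setX (nonexceptional P) (nonexceptional Q)
     | ~~ regular_block eps A B.1 B.2].

Definition regular_partition (R : realType) (eps : R) (m n : nat)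
    (A : 'M[R]_(m, n)) (P : expartition 'I_m) (Q : expartition 'I_n) : Prop :=
  [/\ balanced P /\ balanced Q,
      #|exceptional P|%:R < eps * m%:R,
      #|exceptional Q|%:R < eps * n%:R
    & #|irregular_blocks eps A P Q|%:R
        <= eps * (nclasses P)%:R * (nclasses Q)%:R].

(* For [A = 0] the scalar is [_ / 0 = 0], so the normalized matrix is [0]. *)
Definition normalized (R : realType) (m n : nat) (A : 'M[R]_(m, n)) :
    'M[R]_(m, n) :=
  (m%:R * n%:R / mx_l1norm A) *: A.

(* This is $(\epsilon)$-regularity, with parentheses: [eps]-regularity of the
   normalized matrix. *)
Definition normalized_regular (R : realType) (eps : R) (m n : nat)
    (A : 'M[R]_(m, n)) (P : expartition 'I_m) (Q : expartition 'I_n) : Prop :=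
  regular_partition eps (normalized A) P Q.

(* Main.v *)
Require Import Defs.
From mathcomp Require Import all_boot all_order all_algebra.
From mathcomp Require Import reals.
From mathcomp Require Import ring lra zify.

Set Implicit Arguments.
Unset Strict Implicit.
Unset Printing Implicit Defensive.

Import Order.TTheory GRing.Theory Num.Theory.
Local Open Scope ring_scope.

(** For a large constant [K] let [phi] be the square on [[-K, K]], continued
    linearly outside, and measure a pair of partitions by the sum of [phi] over
    the block averages of the normalized matrix. Linear growth bounds this energy
    by [2 * K * m * n] for every matrix of norm at most [m * n], with no bound on
    the entries. By convexity it does not decrease under refinement. By the norm
    bound, at most half of the irregular blocks can have a density above [8 / eps]
    in absolute value; on the remaining ones [phi] is still quadratic, so cutting
    along the sets that witness irregularity raises the energy by a fixed multiple
    of [m * n]. This can happen only boundedly often. *)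

(** * The Huber function and its Bregman divergence *)

Definition huber (R : realDomainType) (K t : R) : R :=
  if `|t| <= K then t ^+ 2 else 2 * K * `|t| - K ^+ 2.

(** For nonnegative [K], [2 * clip K t] is the derivative of [huber K] at [t]. *)
Definition clip (R : realDomainType) (K t : R) : R :=
  if `|t| <= K then t else if 0 <= t then K else - K.

Definition bregman (R : realDomainType) (K s t : R) : R :=
  huber K s - huber K t - 2 * clip K t * (s - t).

Lemma huber_ge0 (R : realDomainType) (K t : R) : 0 <= K -> 0 <= huber K t.
Proof.
move=> K0; rewrite /huber; case: (lerP `|t| K) => [_|tK]; first exact: sqr_ge0.
by nra.
Qed.

Lemma huber_le (R : realDomainType) (K t : R) :
  0 <= K -> huber K t <= 2 * K * `|t|.
Proof.
move=> K0; rewrite /huber; case: (lerP `|t| K) => [tK|tK]; last by nra.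
by rewrite -real_normK ?num_real //; have := normr_ge0 t; nra.
Qed.

(** The left-hand side is the tangent to the parabola at [c]. It stays below the parabola, and its
    slope is at most [2 * K] in absolute value, so it stays below the linear pieces too. *)
Lemma huber_ge_line (R : realDomainType) (K s c : R) :
  `|c| <= K -> 2 * c * s - c ^+ 2 <= huber K s.
Proof.
move=> cK; rewrite /huber; case: (lerP `|s| K) => sK.
  by rewrite -subr_ge0 (_ : _ - _ = (s - c) ^+ 2) ?sqr_ge0 //; ring.
have cs : c * s <= `|c| * `|s| by rewrite -normrM ler_norm.
rewrite -(real_normK (num_real c)).
have : 0 <= (K - `|c|) * (2 * `|s| - K - `|c|) by apply: mulr_ge0; lra.
by move: cs; rewrite -mulrA; move: `|c| `|s| (c * s) => x y z; lra.
Qed.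

Lemma bregman_ge0 (R : realDomainType) (K s t : R) :
  0 <= K -> 0 <= bregman K s t.
Proof.
move=> K0; have cK : `|clip K t| <= K.
  rewrite /clip; case: ifP => // _.
  by case: ifP => _; rewrite ?normrN ger0_norm.
(* The tangent at [t] is also the tangent at [clip K t], even on the linear pieces. *)
rewrite /bregman; have -> : huber K t = 2 * clip K t * t - clip K t ^+ 2.
  rewrite /huber /clip; case: (lerP `|t| K) => _; first by ring.
  by case: (ger0P t) => _; ring.
by have := huber_ge_line s cK; lra.
Qed.

(* The right-hand side is tangent to [(s - t) ^+ 2] at [`|s - t| = e]; being affine
   in [`|s - t|], it can be averaged over [s]. *)
Lemma bregman_ge (R : realDomainType) (K e s t : R) :
  0 <= e -> `|t| + e <= K -> 2 * e * `|s - t| - e ^+ 2 <= bregman K s t.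
Proof.
move=> e0 tK; rewrite /bregman /huber /clip.
have -> : `|t| <= K by lra.
case: (lerP `|s| K) => sK.
  rewrite -subr_ge0.
  have -> : s ^+ 2 - t ^+ 2 - 2 * t * (s - t) - (2 * e * `|s - t| - e ^+ 2)
    = (`|s - t| - e) ^+ 2.
    by rewrite sqrrB real_normK ?num_real //; ring.
  exact: sqr_ge0.
(* When [|s|] exceeds [K], these bounds make both factors of the excess product below
   nonnegative. *)
have [t1 t2] : t <= K - e /\ - t <= K - e.
  by have := ler_norm t; have := ler_norm (- t); rewrite normrN; lra.
case: (ger0P s) sK => s0 sK.
  rewrite ger0_norm; last by lra.
  have -> : 2 * K * s - K ^+ 2 - t ^+ 2 - 2 * t * (s - t)
    = 2 * e * (s - t) - e ^+ 2 + (K - t - e) * (2 * (s - t) - (K - t) - e) by ring.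
  by rewrite lerDl mulr_ge0 //; lra.
rewrite ler0_norm; last by lra.
have -> : 2 * K * - s - K ^+ 2 - t ^+ 2 - 2 * t * (s - t)
  = 2 * e * - (s - t) - e ^+ 2 + (K + t - e) * (2 * (t - s) - (K + t) - e) by ring.
by rewrite lerDl mulr_ge0 //; lra.
Qed.

(** * Averages over the cells of a partition, and the energy *)

(** The cell average is kept as a function on [T], so that averages over a partition and over a
    refinement can be compared pointwise. *)
Definition condexp (R : fieldType) (T : finType) (D : eqType) (F : T -> D)
    (A : T -> R) (t : T) : R :=
  (\sum_(s | F s == F t) A s) / #|[set s | F s == F t]|%:R.

Lemma condexp_eq (R : fieldType) (T : finType) (D : eqType) (F : T -> D)
    (A : T -> R) (s t : T) : F s = F t -> condexp F A s = condexp F A t.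
Proof. by rewrite /condexp => ->. Qed.

(** After exchanging the sums, the weights [1 / N s] add up to 1 over the cell of [s]. Averaging is
    thus the orthogonal projection onto the functions constant on cells. *)
Lemma condexp_proj (R : numFieldType) (T : finType) (D : eqType) (F : T -> D)
    (A c : T -> R) :
    (forall s t, F s = F t -> c s = c t) ->
  \sum_t c t * condexp F A t = \sum_t c t * A t.
Proof.
move=> cF; pose N t : R := #|[set s | F s == F t]|%:R.
transitivity (\sum_t \sum_(s | F s == F t) c s * A s / N s).
  apply: eq_bigr => t _; rewrite /condexp mulr_suml mulr_sumr.
  apply: eq_bigr => s /eqP Fst.
  by rewrite /N Fst (cF _ _ Fst) mulrA.
rewrite (exchange_big_dep predT) //=; apply: eq_bigr => s _.
rewrite sumr_const -mulr_natl.
have -> : #|[pred t | F s == F t]|%:R = N s.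
  by rewrite /N; congr _%:R; apply: eq_card => t; rewrite !inE eq_sym.
have N0 : N s != 0.
  by rewrite /N pnatr_eq0 -lt0n; apply/card_gt0P; exists s; rewrite inE.
by rewrite mulrC mulfVK.
Qed.

(** Pair with the sign of the average, which is constant on cells. *)
Lemma sum_norm_condexp_le (R : realFieldType) (T : finType) (D : eqType)
    (F : T -> D) (A : T -> R) :
  \sum_t `|condexp F A t| <= \sum_t `|A t|.
Proof.
under eq_bigr => t _ do rewrite normrEsg.
rewrite condexp_proj; last by move=> s t /condexp_eq->.
apply: ler_sum => t _; apply: le_trans (ler_norm _) _.
by rewrite normrM normr_sg; case: (_ != 0); rewrite ?mul0r ?mul1r.
Qed.

(** Summing over points weights each cell by its size. *)
Definition energy (R : realFieldType) (T : finType) (D : eqType) (K : R)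
    (F : T -> D) (A : T -> R) : R := \sum_t huber K (condexp F A t).

Lemma energy_ge0 (R : realFieldType) (T : finType) (D : eqType) (K : R)
    (F : T -> D) (A : T -> R) :
  0 <= K -> 0 <= energy K F A.
Proof. by move=> K0; apply: sumr_ge0 => t _; apply: huber_ge0. Qed.

Lemma energy_le (R : realFieldType) (T : finType) (D : eqType) (K : R)
    (F : T -> D) (A : T -> R) :
  0 <= K -> energy K F A <= 2 * K * \sum_t `|A t|.
Proof.
move=> K0; apply: (@le_trans _ _ (2 * K * \sum_t `|condexp F A t|)).
  by rewrite mulr_sumr; apply: ler_sum => t _; apply: huber_le.
by rewrite ler_wpM2l ?sum_norm_condexp_le // mulr_ge0.
Qed.

(** A Pythagorean identity: the linear terms cancel by [condexp_proj], because the slope of the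
    tangent is constant on the cells of [F], hence on those of [F']. *)
Lemma energy_refine (R : realFieldType) (T : finType) (D D' : eqType) (K : R)
    (F : T -> D) (F' : T -> D') (A : T -> R) :
    (forall s t, F' s = F' t -> F s = F t) ->
  energy K F' A =
  energy K F A + \sum_t bregman K (condexp F' A t) (condexp F A t).
Proof.
move=> ref; rewrite /bregman !sumrB /energy.
suff -> : \sum_t 2 * clip K (condexp F A t) *
   (condexp F' A t - condexp F A t) = 0 by ring.
under eq_bigr => t _ do rewrite mulrBr.
rewrite sumrB !condexp_proj ?subrr //.
  by move=> s t /condexp_eq->.
by move=> s t /ref/condexp_eq->.
Qed.

(** [B] is a union of cells, so averaging preserves the sum over [B], and the deviation of that sum
    from [d] survives. In the application [F] is the refined partition and [d] the density of a
    coarse block. *)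
Lemma bregman_gain (R : realFieldType) (T : finType) (D : eqType) (K e d : R)
    (F : T -> D) (A : T -> R) (B : {set T}) :
    (forall s t, F s = F t -> (s \in B) = (t \in B)) ->
    0 <= e -> `|d| + e <= K -> e * #|B|%:R <= `|\sum_(t in B) (A t - d)| ->
  e ^+ 2 * #|B|%:R <= \sum_(t in B) bregman K (condexp F A t) d.
Proof.
move=> BF e0 dK dev.
apply: (@le_trans _ _ (\sum_(t in B) (2 * e * `|condexp F A t - d| - e ^+ 2))).
  rewrite sumrB -mulr_sumr sumr_const -[_ *+ _]mulr_natr.
  have : e * #|B|%:R <= \sum_(t in B) `|condexp F A t - d|.
    apply: le_trans dev _.
    have -> : \sum_(t in B) (A t - d) = \sum_(t in B) (condexp F A t - d).
      rewrite !sumrB; congr (_ - _).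
      pose c t : R := (t \in B)%:R.
      have cE (f : T -> R) : \sum_(t in B) f t = \sum_t c t * f t.
        rewrite big_mkcond; apply: eq_bigr => t _; rewrite /c.
        by case: (t \in B); rewrite ?mul1r ?mul0r.
      by rewrite !cE condexp_proj // /c => s t /BF->.
    exact: ler_norm_sum.
  by move=> /(ler_wpM2l e0); lra.
by apply: ler_sum => t _; apply: bregman_ge.
Qed.

(** [p] recovers the index of a set from any of its points, which makes the sets [B i] disjoint. *)
Lemma sum_disjoint_le (R : numDomainType) (I T : finType) (G : {set I})
    (B : I -> {set T}) (p : T -> option I) (f : T -> R) :
    (forall t, 0 <= f t) -> (forall i t, t \in B i -> p t = Some i) ->
  \sum_(i in G) \sum_(t in B i) f t <= \sum_t f t.
Proof.
move=> f0 Bp; rewrite (partition_big p predT) //=.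
rewrite (bigD1 None) //= ler_wpDl ?sumr_ge0 //.
rewrite (reindex_omap Some id) /=; last by case.
under [leRHS]eq_bigl => i do rewrite eqxx.
rewrite [leRHS](bigID (mem G)) /= ler_wpDr ?sumr_ge0 // => [i _|].
  exact: sumr_ge0.
apply: ler_sum => i _; rewrite big_mkcond [leRHS]big_mkcond /=.
apply: ler_sum => t _; case: ifP => [/Bp->|_]; first by rewrite eqxx.
by case: ifP.
Qed.

(** * Equitable partitions given by labellings *)

(** A map to [option 'I_k] encodes a partition with an exceptional class, whose points are sent to
    [None]. *)
Definition fibre (T : finType) (k : nat) (f : T -> option 'I_k) (i : 'I_k) :
  {set T} := [set x | f x == Some i].

Definition leftover (T : finType) (k : nat) (f : T -> option 'I_k) : {set T} :=
  [set x | f x == None].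

Lemma pigeonhole_fibre (T G : finType) (g : T -> G) (S : {set T}) (s : nat) :
  (#|G| * s <= #|S|)%N -> (0 < #|G|)%N ->
  exists B : {set T},
    [/\ B \subset S, #|B| = s & {in B &, forall x y, g x = g y}].
Proof.
move=> GS G0.
have [c le_s] : exists c, (s <= #|[set x in S | g x == c]|)%N.
  apply/existsP; apply: contraLR GS => /existsPn small; rewrite -ltnNge.
  have -> : #|S| = (\sum_c #|[set x in S | g x == c]|)%N.
    rewrite -sum1_card (partition_big g predT) //=; apply: eq_bigr => c _.
    by rewrite -sum1_card; apply: eq_bigl => x; rewrite inE.
  have /card_gt0P[c0 _] := G0.
  rewrite -sum_nat_const (bigD1 c0) //= [ltnRHS](bigD1 c0) //= -addSn.
  by apply: leq_add; rewrite ?ltnNge ?small // leq_sum // => c _;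
    rewrite ltnW // ltnNge small.
have /card_geqP[l [ul sl lS]] := le_s.
have {}lS x : x \in l -> (x \in S) && (g x == c) by move=> /lS; rewrite inE.
exists [set x in l]; split.
- by apply/subsetP => x; rewrite inE => /lS/andP[].
- by rewrite cardsE (card_uniqP ul).
- by move=> x y; rewrite !inE => /lS/andP[_ /eqP->] /lS/andP[_ /eqP->].
Qed.

(** Greedy choice: as long as a class remains to be cut, more than [#|G| * s] points are reserved
    for it, so [pigeonhole_fibre] applies. *)
Lemma chop (T G : finType) (g : T -> G) (q s : nat) (S : {set T}) :
    (0 < #|G|)%N -> ((q + #|G|) * s <= #|S|)%N ->
  exists h : T -> option 'I_q,
    [/\ forall x, h x -> x \in S, forall i, #|fibre h i| = s
      & forall x y, h x -> h x = h y -> g x = g y].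
Proof.
move=> G0; elim: q S => [|q IHq] S leS.
  by exists (fun=> None); split => // -[].
have [|B [BS cB gB]] := @pigeonhole_fibre _ _ g S s _ G0; first by lia.
have [|h [hS hc hg]] := IHq (S :\: B).
  by have := cardsID B S; rewrite (setIidPr BS) cB; lia.
pose h' x := if x \in B then Some ord0 else omap (lift ord0) (h x).
have hB x : h x -> x \in B = false by move=> /hS; rewrite inE => /andP[/negPf].
exists h'; split=> [x|i|x y]; rewrite /h'.
- case: ifP => [/(subsetP BS)//|_]; case hx: (h x) => // _.
  by have := hS x; rewrite hx inE => /(_ isT)/andP[].
- have [j ->|->] := unliftP ord0 i.
    rewrite -(hc j); apply: eq_card => x; rewrite !inE.
    case: ifP => [xB|_]; last first.
      by case: (h x) => //= a; rewrite !(inj_eq Some_inj) (inj_eq lift_inj).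
    rewrite (inj_eq Some_inj) -(inj_eq Some_inj) eqE /=.
    by symmetry; apply/negbTE/negP => /eqP hx; have := hB x; rewrite hx xB => /(_ isT).
  rewrite -cB; apply: eq_card => x; rewrite !inE.
  by case: ifP => // _; case: (h x).
- case: ifP => xB; case: ifP => yB //.
  + by move=> _ _; apply: gB.
  + by case: (h y).
  + by case: (h x).
  case hx: (h x) => [a|//] _; case hy: (h y) => [b|//] /= [ab].
  apply: hg; rewrite ?hx ?hy //; congr Some; apply: val_inj.
  by have := ab; rewrite /bump /=; lia.
Qed.

Lemma card_leftover (T : finType) (k s : nat) (f : T -> option 'I_k) :
  (forall i, #|fibre f i| = s) -> (k * s + #|leftover f| = #|T|)%N.
Proof.
move=> fs; rewrite -[RHS]sum1_card (partition_big f predT) //=.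
rewrite (bigD1 None) //= addnC; congr (_ + _)%N.
  by rewrite -sum1_card; apply: eq_bigl => x; rewrite inE.
rewrite (reindex_omap Some id) /=; last by case.
under eq_bigl => i do rewrite eqxx.
rewrite -[k in LHS]card_ord -sum_nat_const; apply: eq_bigr => i _.
by rewrite -(fs i) -sum1_card; apply: eq_bigl => x; rewrite inE.
Qed.

(** Cutting [r] times as many classes as [g] has values keeps the newly lost points to a fraction
    [2 / r] of [T]. *)
Lemma equitable_refinement (T G : finType) (g : T -> G) (r : nat) (S : {set T}) :
    (0 < #|G|)%N -> (1 < r)%N -> (#|T| <= 2 * #|S|)%N ->
    (r.+1 * (#|G| * r) <= #|T|)%N ->
  exists (h : T -> option 'I_(#|G| * r)) (s : nat),
    [/\ (0 < s)%N /\ forall i, #|fibre h i| = s,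
        forall x, h x -> x \in S,
        forall x y, h x -> h x = h y -> g x = g y
      & (#|leftover h| * r <= #|~: S| * r + 2 * #|T|)%N].
Proof.
move=> G0 r1 TS big; set q := (#|G| * r)%N; pose s := (#|S| %/ (q + #|G|))%N.
have s0 : (0 < s)%N.
  rewrite divn_gt0 ?addn_gt0 ?G0 ?orbT // /q.
  by nia.
have [|h [hS hc hg]] := @chop _ _ g q s S G0; first by rewrite mulnC leq_divM.
exists h, s; split=> //.
have qs := card_leftover hc; have cS := cardsC S.
have := ltn_ceil #|S| (_ : 0 < q + #|G|)%N; rewrite addn_gt0 G0 orbT => /(_ isT).
rewrite -/s => lt_S.
have le_S : (s * (q + #|G|) <= #|S|)%N by apply: leq_divM.
rewrite -/q in big; have qE : q = (#|G| * r)%N by [].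
clear s0 hS hc hg; clearbody q; move: qs cS lt_S le_S big TS r1 qE.
move: #|leftover h| #|S| #|~: S| #|T| #|G| s => l a b t c s' qs cS lt_S le_S big TS r1 qE; subst q.
(* The term [c * s'] is the reserve of the greedy choice, and [c * r + c] bounds the remainder of
   the division. Multiplied by [r], each of the two is at most [t]. *)
have : (l <= b + c * s' + c * r + c)%N by nia.
move=> lb; have : (l * r <= (b + c * s' + c * r + c) * r)%N by rewrite leq_mul.
by nia.
Qed.

(** * The energy increment from irregular blocks *)

(* Leftover points are singletons of the labelled partition, so that enlarging
   the exceptional class refines it and cannot decrease the energy. *)
Definition label (T : finType) (k : nat) (f : T -> option 'I_k) (x : T) :
  'I_k + T := if f x is Some i then inl i else inr x.

Lemma label_eq (T : finType) (k : nat) (f : T -> option 'I_k) (x y : T) :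
  label f x = label f y -> x = y \/ f x /\ f x = f y.
Proof.
rewrite /label; case: (f x) => [i|]; case: (f y) => [j|] //.
  by case=> ->; right.
by case=> ->; left.
Qed.

Lemma label_Some (T : finType) (k : nat) (f : T -> option 'I_k) (x : T)
    (i : 'I_k) : (label f x == inl i) = (f x == Some i).
Proof. by rewrite /label; case: (f x). Qed.

Definition block_label (V W : finType) (k : nat) (f : V -> option 'I_k)
    (g : W -> option 'I_k) (t : V * W) := (label f t.1, label g t.2).

Definition entry (R : realType) (m n : nat) (A : 'M[R]_(m, n))
  (t : 'I_m * 'I_n) : R := A t.1 t.2.

Lemma sum_entry (R : realType) (m n : nat) (A : 'M[R]_(m, n))
    (X : {set 'I_m}) (Y : {set 'I_n}) :
  \sum_(t in setX X Y) entry A t = weight A X Y.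
Proof.
rewrite /weight pair_big_dep /=; apply: eq_bigl => -[x y].
by rewrite in_setX.
Qed.

Lemma sum_norm_entry (R : realType) (m n : nat) (A : 'M[R]_(m, n)) :
  \sum_t `|entry A t| = mx_l1norm A.
Proof. by rewrite /mx_l1norm pair_big. Qed.

Lemma condexp_block (R : realType) (m n k : nat) (A : 'M[R]_(m, n))
    (f : 'I_m -> option 'I_k) (g : 'I_n -> option 'I_k) (i j : 'I_k)
    (t : 'I_m * 'I_n) :
    t \in setX (fibre f i) (fibre g j) ->
  condexp (block_label f g) (entry A) t = density A (fibre f i) (fibre g j).
Proof.
rewrite !inE => /andP[/eqP fi /eqP gj].
have cell s : (block_label f g s == block_label f g t)
    = (s \in setX (fibre f i) (fibre g j)).
  rewrite /block_label xpair_eqE {2 4}/label fi gj !label_Some !inE.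
  by [].
rewrite /condexp /density -sum_entry -natrM -cardsX; congr (_ / _%:R).
  by apply: eq_bigl.
by apply: eq_card => s; rewrite inE cell.
Qed.

(** At least [e * k ^ 2 / 2] irregular pairs have density at most [8 / e] in absolute value. The
    witness of each has at least [e ^ 2 * s * s'] cells, with an average gain of [e ^ 2]. Since
    [k ^ 2 * s * s'] is at least [m * n / 4], this yields [e ^ 5 / 8]. *)
Lemma energy_gain (R : realType) (m n k k' s s' : nat) (e : R)
    (A : 'M[R]_(m, n)) (f : 'I_m -> option 'I_k) (g : 'I_n -> option 'I_k)
    (f' : 'I_m -> option 'I_k') (g' : 'I_n -> option 'I_k')
    (I : {set 'I_k * 'I_k}) (X : 'I_k * 'I_k -> {set 'I_m})
    (Y : 'I_k * 'I_k -> {set 'I_n}) :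
    0 < e -> (0 < s)%N -> (0 < s')%N ->
    (forall i, #|fibre f i| = s) -> (forall i, #|fibre g i| = s') ->
    (m <= 2 * (k * s))%N -> (n <= 2 * (k * s'))%N ->
    mx_l1norm A <= m%:R * n%:R -> e * k%:R * k%:R <= #|I|%:R ->
    (forall p, p \in I ->
       [/\ X p \subset fibre f p.1, Y p \subset fibre g p.2,
           e * s%:R <= #|X p|%:R, e * s'%:R <= #|Y p|%:R
         & e < `|density A (X p) (Y p)
                 - density A (fibre f p.1) (fibre g p.2)|]) ->
    (forall x y, label f' x = label f' y ->
       label f x = label f y /\ forall p, (x \in X p) = (y \in X p)) ->
    (forall x y, label g' x = label g' y ->
       label g x = label g y /\ forall p, (x \in Y p) = (y \in Y p)) ->
  energy (8 / e + e) (block_label f g) (entry A)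
    + e ^+ 5 / 8 * (m%:R * n%:R)
  <= energy (8 / e + e) (block_label f' g') (entry A).
Proof.
move=> e0 s0 s'0 fs gs ms ns Amn Ibig Iirr ff gg; set K := 8 / e + e.
pose d p := density A (fibre f p.1) (fibre g p.2).
pose Bl p := setX (fibre f p.1) (fibre g p.2).
pose pos (t : 'I_m * 'I_n) :=
  if (f t.1, g t.2) is (Some i, Some j) then Some (i, j) else None.
have posP p t : t \in Bl p -> pos t = Some p.
  by case: p => i j; rewrite !inE /pos => /andP[/eqP-> /eqP->].
have S0 : 0 < s%:R * s'%:R :> R by rewrite mulr_gt0 ?ltr0n.
have mnS : m%:R * n%:R <= 4 * (k%:R * k%:R) * (s%:R * s'%:R) :> R.
  by rewrite -!natrM ler_nat; have := leq_mul ms ns; lia.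
(* A dense block carries norm above [8 / e * s * s'], out of a total of at most
   [4 * k ^ 2 * s * s']; this caps their number. *)
pose dense := [set p in I | 8 / e < `|d p|].
have dense_le : #|dense|%:R <= e * k%:R * k%:R / 2.
  have : \sum_(p in dense) \sum_(t in Bl p) `|entry A t| <= m%:R * n%:R.
    apply: le_trans Amn; rewrite -sum_norm_entry.
    by apply: (@sum_disjoint_le _ _ _ _ _ pos).
  have : \sum_(p in dense) 8 / e * (s%:R * s'%:R)
      <= \sum_(p in dense) \sum_(t in Bl p) `|entry A t|.
    apply: ler_sum => p; rewrite inE => /andP[_ dp].
    apply: le_trans (ler_norm_sum _ _ _); rewrite sum_entry.
    move: dp; rewrite /d /density fs gs normrM normfV (gtr0_norm S0).
    by rewrite ltr_pdivlMr // => /ltW.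
  rewrite sumr_const -[leLHS]mulr_natr => h1 h2.
  have := le_trans (le_trans h1 h2) mnS.
  rewrite mulrAC ler_pM2r // => h3.
  have := ler_wpM2l (ltW e0) h3.
  have -> : e * (8 / e * #|dense|%:R) = 8 * #|dense|%:R :> R.
    by field; rewrite gt_eqF.
  by lra.
have sparse_ge : e * k%:R * k%:R / 2 <= #|I :\: dense|%:R.
  have := cardsID dense I; rewrite (setIidPr _); last first.
    by apply/subsetP => p; rewrite inE => /andP[].
  by move=> cI; move: Ibig; rewrite -cI natrD; lra.
have K0 : 0 <= K by rewrite addr_ge0 ?divr_ge0 ?ltW.
rewrite (@energy_refine _ _ _ _ K (block_label f g) (block_label f' g')).
  2: by move=> x y [/ff[fx _] /gg[gx _]]; rewrite /block_label fx gx.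
rewrite lerD2l; set F := block_label f g; set F' := block_label f' g'.
pose B p := setX (X p) (Y p).
have BBl p : p \in I -> B p \subset Bl p.
  by move=> /Iirr[XV YW _ _ _]; rewrite setXS.
apply: (@le_trans _ _ (\sum_(p in I :\: dense) \sum_(t in B p)
    bregman K (condexp F' (entry A) t) (condexp F (entry A) t))); last first.
  (* Outside [I] nothing places [B p] inside its block, so disjointness is secured by taking the
     empty set there. *)
  pose B' p := if p \in I then B p else set0.
  rewrite (eq_bigr (fun p => \sum_(t in B' p)
    bregman K (condexp F' (entry A) t) (condexp F (entry A) t))); last first.
    by move=> p; rewrite /B' inE => /andP[_ ->].
  apply: (@sum_disjoint_le _ _ _ _ _ pos) => [t|p t]; first exact: bregman_ge0.
  rewrite /B'; case: ifP => pI; last by rewrite inE.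
  by move=> /(subsetP (BBl p pI)) /posP.
apply: (@le_trans _ _ (\sum_(p in I :\: dense)
    e ^+ 2 * (e ^+ 2 * (s%:R * s'%:R)))).
  rewrite sumr_const -[leRHS]mulr_natr.
  have e4S : 0 <= e ^+ 2 * (e ^+ 2 * (s%:R * s'%:R)) :> R.
    by rewrite !mulr_ge0 ?exprn_ge0 // ltW.
  apply: le_trans _ (ler_wpM2l e4S sparse_ge).
  have e5 : 0 <= e ^+ 5 / 8 by rewrite divr_ge0 ?exprn_ge0 // ltW.
  apply: le_trans (ler_wpM2l e5 mnS) _.
  by rewrite le_eqVlt; apply/orP; left; apply/eqP; field.
apply: ler_sum => p; rewrite !inE negb_and -leNgt => /andP[npd pI].
have [XV YW Xs Ys dev] := Iirr p pI.
have {}npd : `|d p| <= 8 / e by move: npd; rewrite pI.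
rewrite (eq_bigr (fun t => bregman K (condexp F' (entry A) t) (d p))); last first.
  by move=> t /(subsetP (BBl p pI)); case: (p) => i j /condexp_block ->.
have B_ge : e ^+ 2 * (s%:R * s'%:R) <= #|B p|%:R.
  rewrite cardsX natrM.
  have -> : e ^+ 2 * (s%:R * s'%:R) = (e * s%:R) * (e * s'%:R) by ring.
  by apply: ler_pM => //; rewrite mulr_ge0 // ltW.
apply: le_trans (_ : e ^+ 2 * #|B p|%:R <= _).
  by rewrite ler_wpM2l ?exprn_ge0 // ltW.
(* The summand [e] of [K] is the margin required above the density bound [8 / e]. *)
apply: bregman_gain.
- move=> [x y] [x' y'] [/ff[_ xX] /gg[_ yY]] /=.
  by rewrite !inE /= xX yY.
- exact: ltW.
- by rewrite /K lerD2r.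
have B0 : 0 < #|B p|%:R :> R.
  by apply: lt_le_trans B_ge; rewrite mulr_gt0 ?exprn_gt0.
rewrite sumrB sum_entry sumr_const -(mulr_natr (d p)).
have -> : weight A (X p) (Y p) = density A (X p) (Y p) * #|B p|%:R.
  by rewrite /density -natrM -cardsX divfK // gt_eqF.
by rewrite -mulrBl normrM (gtr0_norm B0) ler_pM2r // ltW.
Qed.

(** * Refining until most blocks are regular *)

(** Positivity of [s] keeps the [k] classes nonempty, hence distinct as sets. *)
Definition equitable (T : finType) (k : nat) (f : T -> option 'I_k) : Prop :=
  exists2 s, (0 < s)%N & forall i, #|fibre f i| = s.

(** A point is described by its class and by the set of opposite classes whose marked set contains
    it; [next] is [r] times the number of such descriptions. *)
Definition next (r k : nat) : nat := (#|{: option 'I_k * {set 'I_k}}| * r)%N.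

Lemma next_ge (r k : nat) : (0 < r)%N -> (k <= next r k)%N.
Proof.
move=> r0; have inj : injective (fun i : 'I_k => (Some i, set0 : {set 'I_k})).
  by move=> i j [].
rewrite -[leqLHS]card_ord (leq_trans (leq_card _ inj)) //.
exact: leq_pmulr.
Qed.

Lemma iter_next_le (r k i j : nat) :
  (0 < r)%N -> (i <= j)%N -> (iter i (next r) k <= iter j (next r) k)%N.
Proof.
move=> r0; elim: j => [|j IHj]; first by rewrite leqn0 => /eqP->.
rewrite leq_eqVlt => /orP[/eqP->//|/IHj/leq_trans]; apply.
exact: next_ge.
Qed.

(* [X i j] is the subset of the [i]-th class to be cut out because of the [j]-th
   class of the other side. *)
Lemma marked_refinement (T : finType) (k r : nat) (f : T -> option 'I_k)
    (X : 'I_k -> 'I_k -> {set T}) :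
    (1 < r)%N -> (#|leftover f| * 2 <= #|T|)%N ->
    (r.+1 * next r k <= #|T|)%N -> (forall i j, X i j \subset fibre f i) ->
  exists f' : T -> option 'I_(next r k),
    [/\ equitable f',
        forall x y, label f' x = label f' y ->
          label f x = label f y /\ forall i j, (x \in X i j) = (y \in X i j)
      & (#|leftover f'| * r <= #|leftover f| * r + 2 * #|T|)%N].
Proof.
move=> r1 small big Xf.
pose g x : option 'I_k * {set 'I_k} :=
  (f x, [set j | if f x is Some i then x \in X i j else false]).
have G0 : (0 < #|{: option 'I_k * {set 'I_k}}|)%N.
  by apply/card_gt0P; exists (None, set0).
have cC := cardsC (leftover f).
have [|f' [s [[s0 fs] fS fg loss]]] :=
  @equitable_refinement _ _ g r (~: leftover f) G0 r1 _ big; first by lia.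
exists f'; split; [by exists s | | by rewrite setCK in loss].
move=> x y /label_eq[->//|[fx fxy]].
have [fE /setP XE] := fg _ _ fx fxy; rewrite /label -fE.
have := fS _ fx; rewrite !inE; case fx' : (f x) => [i|//] _; split=> // i' j.
have [->|ne] := eqVneq i' i.
  by have := XE j; rewrite !inE -fE fx'.
(* A marked set lies in its own class, so it contains no point of another class. *)
have out z : f z = Some i -> z \in X i' j = false.
  move=> fz; apply/negbTE/negP => /(subsetP (Xf i' j)).
  by rewrite inE fz => /eqP[ii]; rewrite ii eqxx in ne.
by rewrite !out // -fE.
Qed.

Definition irregular_pairs (R : realType) (e : R) (m n k : nat)
    (A : 'M[R]_(m, n)) (f : 'I_m -> option 'I_k) (g : 'I_n -> option 'I_k) :
  {set 'I_k * 'I_k} :=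
  [set p | ~~ regular_block e A (fibre f p.1) (fibre g p.2)].

(** The inclusions are stated for regular blocks too, so that one choice function serves all pairs,
    as [marked_refinement] demands. *)
Lemma irregular_witness (R : realType) (e : R) (m n : nat) (A : 'M[R]_(m, n))
    (X : {set 'I_m}) (Y : {set 'I_n}) :
  exists B : {set 'I_m} * {set 'I_n},
    [/\ B.1 \subset X, B.2 \subset Y
      & ~~ regular_block e A X Y ->
        [/\ e * #|X|%:R <= #|B.1|%:R, e * #|Y|%:R <= #|B.2|%:R
          & e < `|density A B.1 B.2 - density A X Y|]].
Proof.
have [reg|] := boolP (regular_block e A X Y).
  by exists (set0, set0); rewrite !sub0set.
move=> /forallPn[X' /forallPn[Y']]; rewrite negb_imply -ltNge.
by move=> /andP[/and4P[XX YY Xe Ye] dev]; exists (X', Y').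
Qed.

Lemma regular_or_refine (R : realType) (m n k r : nat) (e : R)
    (A : 'M[R]_(m, n)) (f : 'I_m -> option 'I_k) (g : 'I_n -> option 'I_k) :
    0 < e -> (1 < r)%N -> equitable f -> equitable g ->
    (#|leftover f| * 2 <= m)%N -> (#|leftover g| * 2 <= n)%N ->
    (r.+1 * next r k <= m)%N -> (r.+1 * next r k <= n)%N ->
    mx_l1norm A <= m%:R * n%:R ->
  #|irregular_pairs e A f g|%:R <= e * k%:R * k%:R \/
  exists (f' : 'I_m -> option 'I_(next r k))
         (g' : 'I_n -> option 'I_(next r k)),
    [/\ equitable f' /\ equitable g',
        (#|leftover f'| * r <= #|leftover f| * r + 2 * m)%N,
        (#|leftover g'| * r <= #|leftover g| * r + 2 * n)%N
      & energy (8 / e + e) (block_label f g) (entry A)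
          + e ^+ 5 / 8 * (m%:R * n%:R)
        <= energy (8 / e + e) (block_label f' g') (entry A)].
Proof.
move=> e0 r1 [s s0 fs] [s' s'0 gs] fm gn rm rn Amn.
have [?|irr] := lerP #|irregular_pairs e A f g|%:R (e * k%:R * k%:R).
  by left.
right.
have [B BP] := fin_all_exists
  (fun p : 'I_k * 'I_k => irregular_witness e A (fibre f p.1) (fibre g p.2)).
have := @marked_refinement _ k r f (fun i j => (B (i, j)).1) r1.
rewrite card_ord => /(_ fm rm)[i j|f' [ef ff lf]].
  by have [] := BP (i, j).
(* For columns the roles are swapped: [j] is the class being cut and [i] the opposite one. *)
have := @marked_refinement _ k r g (fun j i => (B (i, j)).2) r1.
rewrite card_ord => /(_ gn rn)[i j|g' [eg gg lg]].
  by have [] := BP (j, i).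
exists f', g'; split=> //.
have cf := card_leftover fs; have cg := card_leftover gs.
rewrite !card_ord in cf cg.
apply: (@energy_gain _ _ _ _ _ s s' e A f g f' g' (irregular_pairs e A f g)
   (fun p => (B p).1) (fun p => (B p).2)) => //.
- by lia.
- by lia.
- exact: ltW.
- move=> p; rewrite inE => np; have [XV YW /(_ np)[Xe Ye dev]] := BP p.
  by move: Xe Ye; rewrite fs gs.
- by move=> x y /ff[-> XE]; split=> // -[i j]; apply: XE.
- by move=> x y /gg[-> XE]; split=> // -[i j]; apply: XE.
Qed.

(** The initial partition and each of the [i] refinements lose at most a fraction [2 / r] of the
    points. *)
Definition few_leftover (T : finType) (r i k : nat) (f : T -> option 'I_k) :=
  equitable f /\ (#|leftover f| * r <= 2 * i.+1 * #|T|)%N.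

(** The constant map imposes no constraint; its codomain ['I_L] only fixes the number of classes. *)
Lemma equitable_partition (T : finType) (L r : nat) :
    (0 < L)%N -> (1 < r)%N -> (r.+1 * (L * r) <= #|T|)%N ->
  exists f : T -> option 'I_(L * r), few_leftover r 0 f.
Proof.
move=> L0 r1 big.
have := @equitable_refinement T 'I_L (fun=> Ordinal L0) r [set: T].
rewrite card_ord setCT cards0 cardsT => /(_ L0 r1 _ big)[|f [s [[s0 fs] _ _ lf]]].
  by lia.
by exists f; split; [exists s | lia].
Qed.

(** A regular stage, once found, is kept; otherwise every refinement adds one more energy
    increment. *)
Lemma energy_iteration (R : realType) (m n L r N : nat) (e : R)
    (A : 'M[R]_(m, n)) :
    0 < e -> (0 < L)%N -> (1 < r)%N -> (4 * N.+1 <= r)%N ->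
    (r.+1 * iter N (next r) (L * r) <= m)%N ->
    (r.+1 * iter N (next r) (L * r) <= n)%N ->
    mx_l1norm A <= m%:R * n%:R ->
  forall i, (i <= N)%N ->
  (exists j, (j <= i)%N /\
     exists (f : 'I_m -> option 'I_(iter j (next r) (L * r)))
       (g : 'I_n -> option 'I_(iter j (next r) (L * r))),
     [/\ few_leftover r j f, few_leftover r j g
       & #|irregular_pairs e A f g|%:R <= e * (iter j (next r) (L * r))%:R
           * (iter j (next r) (L * r))%:R]) \/
  exists (f : 'I_m -> option 'I_(iter i (next r) (L * r)))
    (g : 'I_n -> option 'I_(iter i (next r) (L * r))),
    [/\ few_leftover r i f, few_leftover r i g
      & i%:R * (e ^+ 5 / 8 * (m%:R * n%:R))
        <= energy (8 / e + e) (block_label f g) (entry A)].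
Proof.
move=> e0 L0 r1 rN mbig nbig Amn.
have K0 : 0 <= 8 / e + e by rewrite addr_ge0 ?divr_ge0 ?ltW.
have bound i q : (i <= N)%N -> (r.+1 * iter N (next r) (L * r) <= q)%N ->
    (r.+1 * iter i (next r) (L * r) <= q)%N.
  by move=> iN; apply: leq_trans; rewrite leq_mul2l iter_next_le ?orbT // ltnW.
elim=> [|i IHi] iN.
  have [|f fP] := @equitable_partition 'I_m L r L0 r1.
    by rewrite card_ord; apply: (bound 0).
  have [|g gP] := @equitable_partition 'I_n L r L0 r1.
    by rewrite card_ord; apply: (bound 0).
  by right; exists f, g; split=> //; rewrite mul0r energy_ge0.
(* [4 * N.+1 <= r] keeps the leftover below one half through all stages, as the next refinement
   requires. *)
have half q l : (l * r <= 2 * i.+1 * q)%N -> (l * 2 <= q)%N.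
  move=> lr; rewrite -(@leq_pmul2r r) ?(ltnW r1) //.
  have := leq_mul (leqnn q) rN; nia.
have [[j [ji reg]]|[f [g [[ef lf] [eg lg] En]]]] := IHi (ltnW iN).
  by left; exists j; split=> //; apply: leqW.
rewrite !card_ord in lf lg.
have [] := @regular_or_refine R m n _ r e A f g e0 r1 ef eg
  (half _ _ lf) (half _ _ lg) (bound i.+1 m iN mbig) (bound i.+1 n iN nbig) Amn.
  by move=> reg; left; exists i; split=> //; exists f, g; split=> //; split;
    rewrite ?card_ord.
move=> [f' [g' [[ef' eg'] lf' lg' gain]]]; right; exists f', g'; split.
- by split; rewrite // card_ord (leq_trans lf') // mulnS mulnDl addnC leq_add2l.
- by split; rewrite // card_ord (leq_trans lg') // mulnS mulnDl addnC leq_add2l.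
by rewrite -natr1 mulrDl mul1r (le_trans _ gain) // lerD2r.
Qed.

(** * From labellings to block partitions, and the choice of constants *)

(** Nonempty fibres are pairwise distinct and differ from the leftover set, even when that set is
    empty, so removing it leaves exactly [k] classes. *)
Lemma expartition_of (T : finType) (k : nat) (f : T -> option 'I_k) :
    equitable f ->
  exists P : expartition T,
    [/\ exceptional P = leftover f, nclasses P = k
      & nonexceptional P = [set fibre f i | i : 'I_k]].
Proof.
move=> [s s0 fs].
have fibre_neq0 i : exists x, x \in fibre f i.
  by apply/card_gt0P; rewrite fs.
have fibre_inj : injective (fibre f).
  move=> i j ij; have [x xi] := fibre_neq0 i; have := xi.
  by rewrite ij; move: xi; rewrite !inE => /eqP-> /eqP[].
pose F := [set fibre f i | i : 'I_k].
have lF : leftover f \notin F.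
  apply/imsetP => -[i _ lfi]; have [x] := fibre_neq0 i.
  by rewrite -lfi !inE => /eqP fx; have := lfi; move=> /setP/(_ x); rewrite !inE fx.
have P : [&& leftover f \in leftover f |: F, trivIset (leftover f |: F),
    cover (leftover f |: F) == [set: T]
    & set0 \notin (leftover f |: F) :\ leftover f].
  rewrite setU11 setU1K //=; apply/and3P; split.
  - apply/trivIsetP => X Y; rewrite !inE.
    move=> /orP[/eqP->|/imsetP[i _ ->]] /orP[/eqP->|/imsetP[j _ ->]] ne.
    + by rewrite eqxx in ne.
    + by rewrite -setI_eq0; apply/eqP/setP => x; rewrite !inE; case: (f x).
    + rewrite -setI_eq0; apply/eqP/setP => x; rewrite !inE.
      by case: (f x) => //= a; rewrite andbF.
    + rewrite -setI_eq0; apply/eqP/setP => x; rewrite !inE; apply/negbTE/negP.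
      by move=> /andP[/eqP-> /eqP[ij]]; rewrite ij eqxx in ne.
  - apply/eqP/setP => x; rewrite inE; apply/bigcupP.
    case fx: (f x) => [i|].
      by exists (fibre f i); rewrite ?inE ?imset_f ?orbT ?fx.
    by exists (leftover f); rewrite ?inE ?eqxx ?fx.
  - apply/imsetP => -[i _ i0]; have [x] := fibre_neq0 i.
    by rewrite -i0 inE.
exists (ExPartition P); rewrite /nclasses /nonexceptional /= setU1K //.
by split=> //; rewrite card_imset // card_ord.
Qed.

Lemma regular_partition_of (R : realType) (e : R) (m n k : nat)
    (A : 'M[R]_(m, n)) (f : 'I_m -> option 'I_k) (g : 'I_n -> option 'I_k) :
    equitable f -> equitable g ->
    #|leftover f|%:R < e * m%:R -> #|leftover g|%:R < e * n%:R ->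
    #|irregular_pairs e A f g|%:R <= e * k%:R * k%:R ->
  exists (P : expartition 'I_m) (Q : expartition 'I_n),
    [/\ regular_partition e A P Q, nclasses P = k & nclasses Q = k].
Proof.
move=> ef eg lf lg irr.
have [P [Pl Pk PF]] := expartition_of ef.
have [Q [Ql Qk QF]] := expartition_of eg.
exists P, Q; split=> //; split; rewrite ?Pl ?Ql ?Pk ?Qk //.
  have [s _ fs] := ef; have [s' _ gs] := eg.
  by split=> X Y; rewrite ?PF ?QF => /imsetP[i _ ->] /imsetP[j _ ->];
    rewrite ?fs ?gs.
apply: le_trans irr; rewrite ler_nat.
apply: leq_trans
  (leq_imset_card (fun p => (fibre f p.1, fibre g p.2)) _).
apply/subset_leq_card/subsetP => -[X Y].
rewrite inE in_setX /= PF QF => /andP[/andP[/imsetP[i _ ->] /imsetP[j _ ->]] ir].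
by apply/imsetP; exists (i, j); rewrite ?inE.
Qed.

(** Equality holds when the norm of [A] is nonzero; when it is zero, the scalar is zero by the
    convention on division. *)
Lemma mx_l1norm_normalized (R : realType) (m n : nat) (A : 'M[R]_(m, n)) :
  mx_l1norm (normalized A) <= m%:R * n%:R.
Proof.
have N0 : 0 <= mx_l1norm A by do 2!apply: sumr_ge0 => ? _.
have -> : mx_l1norm (normalized A)
    = m%:R * n%:R / mx_l1norm A * mx_l1norm A.
  rewrite {1 3}/mx_l1norm mulr_sumr; apply: eq_bigr => x _.
  rewrite mulr_sumr; apply: eq_bigr => y _.
  by rewrite mxE normrM ger0_norm // divr_ge0 ?mulr_ge0.
have [->|An0] := eqVneq (mx_l1norm A) 0; first by rewrite mulr0 mulr_ge0.
by rewrite divfK.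
Qed.

Theorem theorem3 (R : realType) (eps : R) (heps : 0 < eps)
    (L : nat) (hL : (0 < L)%N) :
  exists M : nat, (0 < M)%N /\
    forall (m n : nat), (M <= m)%N -> (M <= n)%N ->
    forall A : 'M[R]_(m, n),
    exists (P : expartition 'I_m) (Q : expartition 'I_n),
      [/\ normalized_regular eps A P Q,
          (L <= nclasses P <= M)%N & (L <= nclasses Q <= M)%N].
Proof.
pose K := 8 / eps + eps.
have K0 : 0 <= K by rewrite addr_ge0 ?divr_ge0 ?ltW.
(* [N] increments of [eps ^+ 5 / 8] exceed the energy bound [2 * K]. *)
pose N := Num.bound (16 * K / eps ^+ 5).
have NK : 2 * K < N%:R * (eps ^+ 5 / 8).
  have : 16 * K / eps ^+ 5 < N%:R.
    by apply: archi_boundP; rewrite divr_ge0 ?mulr_ge0 ?exprn_ge0 // ltW.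
  by rewrite ltr_pdivrMr ?exprn_gt0 //; lra.
(* The first summand keeps leftovers below one half, the second brings them below the fraction
   [eps]. *)
pose r := (4 * N.+1 + Num.bound ((2 * N.+1)%:R / eps))%N.
have re : (2 * N.+1)%:R < r%:R * eps.
  rewrite -ltr_pdivrMr //; apply: (@lt_le_trans _ _ (Num.bound ((2 * N.+1)%:R / eps))%:R).
    by apply: archi_boundP; rewrite divr_ge0 ?ltW.
  by rewrite ler_nat leq_addl.
have rN : (4 * N.+1 <= r)%N by apply: leq_addr.
have r1 : (1 < r)%N by lia.
pose k i := iter i (next r) (L * r)%N.
have mono i j : (i <= j)%N -> (k i <= k j)%N by apply/iter_next_le/ltnW.
have kL i : (L <= k i)%N.
  by apply: leq_trans (mono 0%N i (leq0n i)); rewrite leq_pmulr // ltnW.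
have M0 : (0 < r.+1 * k N)%N by rewrite muln_gt0 (leq_trans hL (kL N)).
(* This value both makes the matrix large enough for [N] refinements and bounds the number of
   classes at every stage. *)
exists (r.+1 * k N)%N; split=> // m n mM nM A.
have m0 : 0 < m%:R :> R by rewrite ltr0n (leq_trans M0).
have n0 : 0 < n%:R :> R by rewrite ltr0n (leq_trans M0).
have := @energy_iteration R m n L r N eps (normalized A) heps hL r1 rN mM nM
  (mx_l1norm_normalized A) N (leqnn N).
(* If no stage is regular, the accumulated energy contradicts the choice of [N]. *)
case=> [[j [jN [f [g [[ef lf] [eg lg] irr]]]]]|[f [g [_ _ En]]]]; last first.
  have := le_trans En (energy_le _ _ K0); rewrite sum_norm_entry => h.
  have K2 : 0 <= 2 * K by rewrite mulr_ge0.
  have := le_trans h (ler_wpM2l K2 (mx_l1norm_normalized A)).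
  by rewrite [leLHS]mulrA ler_pM2r ?mulr_gt0 // leNgt NK.
have small q l : 0 < q%:R :> R -> (l * r <= 2 * j.+1 * q)%N ->
    l%:R < eps * q%:R.
  move=> q0 lr; rewrite -(@ltr_pM2r _ r%:R) ?ltr0n ?(ltnW r1) //.
  apply: (@le_lt_trans _ _ ((2 * N.+1)%:R * q%:R)).
    by rewrite -!natrM ler_nat (leq_trans lr) // leq_mul2r leq_mul2l ltnS jN !orbT.
  by rewrite mulrAC ltr_pM2r // mulrC.
rewrite !card_ord in lf lg.
have [P [Q [PQ Pk Qk]]] := regular_partition_of ef eg (small _ _ m0 lf)
  (small _ _ n0 lg) irr.
have kM : (k j <= r.+1 * k N)%N by rewrite (leq_trans (mono _ _ jN)) ?leq_pmull.
by exists P, Q; rewrite Pk Qk kL kM.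
Qed.
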